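(* Let $E:=[a,b]\subset\mathbb R$ with $a<b$, let $g\in C^{(2)}(E)$, let $\mathbf x=(x_1,\dots,x_n)$ with all $x_i\in E$, and let $\mathbf p=(p_1,\dots,p_n)$ with $p_i>0$ and $\sum_{i=1}^n p_i=1$. Then $$g(a)+g(b)-2g\Bigl(\frac{a+b}{2}\Bigr)+\frac14 M_g(E)\bigl[2J_n(\mathbf p,\mathbf x;x^2)-(b-a)^2\bigr]\le J_n(\mathbf p,\mathbf x;g)$$ and $$J_n(\mathbf p,\mathbf x;g)\le g(a)+g(b)-2g\Bigl(\frac{a+b}{2}\Bigr)+\frac14 m_g(E)\bigl[2J_n(\mathbf p,\mathbf x;x^2)-(b-a)^2\bigr].$$
   Context: $J_n(\mathbf p,\mathbf x;f):=\sum_{i=1}^n p_i f(x_i)-f\bigl(\sum_{i=1}^n p_i x_i\bigr)$ is the Jensen functional; in particular $J_n(\mathbf p,\mathbf x;x^2)=\sum_{i=1}^n p_i x_i^2-\bigl(\sum_{i=1}^n p_i x_i\bigr)^2$. Also $m_g(E):=\min_{t\in E}g''(t)$ and $M_g(E):=\max_{t\in E}g''(t)$. *)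

(* Defs.v *)
From mathcomp Require Import all_boot all_order all_algebra.
From mathcomp Require Import all_classical all_reals all_analysis.
Set Implicit Arguments.
Unset Strict Implicit.
Unset Printing Implicit Defensive.
Import Order.TTheory GRing.Theory Num.Theory numFieldNormedType.Exports.
Local Open Scope classical_set_scope.
Local Open Scope ring_scope.

Definition jensen (R : realType) (n : nat) (p x : 'I_n -> R) (f : R -> R) : R :=
  \sum_(i < n) p i * f (x i) - f (\sum_(i < n) p i * x i).

Definition diff_quot (R : realType) (f : R -> R) (t y : R) : R :=
  (f y - f t) / (y - t).

(* The library's [derivable] and [derive1] are two-sided.  Here the difference
   quotient is restricted to points of E, so that only the values of f on E
   matter and, when E = [a, b], the derivatives at a and b are one-sided. *)
Definition derivable_on (R : realType) (E : set R) (f : R -> R) : Prop :=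
  forall t, E t -> cvg (diff_quot f t y @[y --> within E t^']).

Definition derive_on (R : realType) (E : set R) (f : R -> R) (t : R) : R :=
  lim (diff_quot f t y @[y --> within E t^']).

Definition derive2_on (R : realType) (E : set R) (f : R -> R) : R -> R :=
  derive_on E (derive_on E f).

(* Continuity of f and of f' on E follows from derivability. *)
Definition C2_on (R : realType) (E : set R) (f : R -> R) : Prop :=
  [/\ derivable_on E f, derivable_on E (derive_on E f) &
      {within E, continuous (derive2_on E f)}].

(* Attained extrema; the default value 0 is returned only if there is none. *)
Definition min_on (R : realType) (E : set R) (f : R -> R) : R :=
  xget 0 ((f @` E) `&` lbound (f @` E)).

Definition max_on (R : realType) (E : set R) (f : R -> R) : R :=
  xget 0 ((f @` E) `&` ubound (f @` E)).

Definition m_ (R : realType) (g : R -> R) (E : set R) : R :=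
  min_on E (derive2_on E g).

Definition M_ (R : realType) (g : R -> R) (E : set R) : R :=
  max_on E (derive2_on E g).

(* Main.v *)
Require Import Defs.
From mathcomp Require Import all_boot all_order all_algebra.
From mathcomp Require Import all_classical all_reals all_analysis.
From mathcomp Require Import ring lra.
Set Implicit Arguments.
Unset Strict Implicit.
Unset Printing Implicit Defensive.
Import Order.TTheory GRing.Theory Num.Theory numFieldNormedType.Exports.
Local Open Scope classical_set_scope.
Local Open Scope ring_scope.

(** Up to a quadratic, [g] is convex in two ways.  If [m] and [M] are the extreme
    values of [g''] on [[a, b]], both [M / 2 * t ^+ 2 - g t] and
    [g t - m / 2 * t ^+ 2] have a nonnegative second derivative.  For a convex
    [h] the Jensen functional obeys a bound independent of the points and of the
    weights:

      [J(p, x; h) <= h a + h b - 2 * h ((a + b) / 2)]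

    ([jensen_le_endpoints]).  Since [J] is linear in the function and the right
    hand side equals [(b - a) ^+ 2 / 2] for the square function, the two convex
    functions give the two inequalities.

    Both cases are instances of [h t = e * g t + c * t ^+ 2], with
    [(e, c) = (-1, M / 2)] and [(e, c) = (1, - m / 2)]; convexity of such an [h]
    is [C2_on_add_sqr_convex].  There the derivatives relative to [[a, b]] are
    two-sided derivatives at interior points, and relative derivability gives
    continuity up to the endpoints, so the classical second derivative test
    applies. *)

Lemma derivable_on_within_continuous (R : realType) (E : set R) (f : R -> R) :
  derivable_on E f -> {within E, continuous f}.
Proof.
move=> df; apply/subspace_continuousP => t Et.
have /cvg_ex[/= l dfl] := df t Et.
have subt : (y - t) @[y --> within E t^'] --> (0 : R).
  rewrite -(subrr t); apply: cvgB; last exact: cvg_cst.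
  exact: cvg_trans (cvg_within _) (@nbhs_dnbhs _ t).
have: (diff_quot f t y * (y - t) + f t) @[y --> within E t^'] --> f t.
  rewrite -[X in _ --> X]add0r -[X in X + _](mulr0 l).
  by apply: cvgD; [exact: cvgM|exact: cvg_cst].
move=> cft U Uft.
have {}cft : \forall y \near t, y != t -> E y ->
    U (diff_quot f t y * (y - t) + f t) by exact: cft U Uft.
change (\forall y \near t, E y -> U (f y)).
apply: filterS cft => y yP Ey.
have [->|yt] := eqVneq y t; first exact: nbhs_singleton.
by have := yP yt Ey; rewrite /diff_quot divfK ?subr_eq0// subrK.
Qed.

(** At an interior point, deleted neighbourhoods relative to [E] are ordinary
    deleted neighbourhoods; what remains is the change of variable
    [y = k + t] in the difference quotient. *)
Lemma derivable_on_is_derive (R : realType) (E : set R) (f : R -> R) (t : R) :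
  derivable_on E f -> E° t -> is_derive t 1 f (derive_on E f t).
Proof.
move=> df Et.
have wE : within E t^' = t^'.
  rewrite eqEsubset; split; last first.
    by move=> U tU; apply: (cvg_within (F := t^') E).
  move=> U UE; change (\forall y \near t, y != t -> U y).
  have {}UE : \forall y \near t, y != t -> E y -> U y by exact: UE.
  by apply: filterS2 Et UE => y Ey UEy yt; exact: UEy.
have dfl : diff_quot f t y @[y --> t^'] --> derive_on E f t.
  by rewrite -wE; exact: df (interior_subset Et).
set l := derive_on E f t in dfl *.
have shiftt : (k + t) @[k --> (0 : R)^'] --> t^'.
  have ct : (k + t) @[k --> (0 : R)] --> t.
    by rewrite -[X in _ --> X]add0r; apply: cvgD; [exact: cvg_id|exact: cvg_cst].
  move=> U UE; change (\forall k \near (0 : R), k != 0 -> U (k + t)).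
  have {}UE : \forall k \near (0 : R), k + t != t -> U (k + t) := ct _ UE.
  apply: filterS UE => k Uk k0; apply: Uk.
  by rewrite -subr_eq0 addrK.
have dl : (fun k : R => k^-1 *: ((f \o shift t) (k *: (1 : R)) - f t)) @ 0^' --> l.
  rewrite (_ : (fun k => _) = diff_quot f t \o (fun k => k + t)).
    exact: cvg_comp shiftt dfl.
  apply/funext => k.
  by rewrite /diff_quot/= addrK [k%:A]mulr1 mulrC.
apply: DeriveDef; first exact: cvgP dl.
exact: cvg_lim dl.
Qed.

(** Let [X] be the barycentre of the [x i], with [X = l a + (1 - l) b].  Bounding
    each [h (x i)] by the chord over [[a, b]] gives
    [\sum_i p i * h (x i) <= l h a + (1 - l) h b].  The mirror image
    [a + b - X] has the barycentric coordinates of [X] exchanged, so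
    [h (a + b - X) <= (1 - l) h a + l h b]: the two bounds add up to [h a + h b].
    Convexity at the midpoint of [X] and [a + b - X], which is [(a + b) / 2],
    trades [h (a + b - X)] for [2 * h ((a + b) / 2) - h X]. *)
Lemma jensen_le_endpoints (R : realType) (a b : R) (h : R -> R) n
    (p x : 'I_n -> R) :
  a < b -> convex_function (`[a, b]%classic : set R) h ->
  (forall i, x i \in `[a, b]) -> (forall i, 0 <= p i) ->
  \sum_(i < n) p i = 1 ->
  jensen p x h <= h a + h b - 2 * h ((a + b) / 2).
Proof.
move=> ab ch xab p0 p1.
have conv l u w : 0 <= l <= 1 -> u \in `[a, b] -> w \in `[a, b] ->
  h (l * u + (1 - l) * w) <= l * h u + (1 - l) * h w.
  move=> /andP[l0 l1] uab wab.
  by have := ch (Itv01 l0 l1) u w; rewrite !inE/= => /(_ uab wab).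
have ba : b - a != 0 by lra.
pose l t := (b - t) / (b - a).
have l01 t : t \in `[a, b] -> 0 <= l t <= 1.
  rewrite in_itv/= => /andP[at_ tb].
  by rewrite divr_ge0 ?ler_pdivrMr ?mul1r ?subr_gt0 ?subr_ge0 ?(ltW ab)//= lerB.
have lE t : l t * a + (1 - l t) * b = t by rewrite /l; field.
have lrE t : (1 - l t) * a + l t * b = a + b - t by rewrite /l; field.
have aab : a \in `[a, b] by rewrite in_itv/= lexx ltW.
have bab : b \in `[a, b] by rewrite in_itv/= lexx ltW.
rewrite /jensen; set X := \sum_i p i * x i.
have Xab : X \in `[a, b].
  rewrite in_itv/= -[a]mul1r -[b]mul1r -p1 !mulr_suml.
  by apply/andP; split; apply: ler_sum => i _; apply: (ler_wpM2l (p0 i));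
    have := xab i; rewrite in_itv/= => /andP[].
have sum_le : \sum_i p i * h (x i) <= l X * h a + (1 - l X) * h b.
  have -> : l X * h a + (1 - l X) * h b
            = \sum_i p i * (l (x i) * h a + (1 - l (x i)) * h b).
    have -> : l X = \sum_i p i * l (x i).
      rewrite /l -[b in b - X]mul1r -p1 mulr_suml -sumrB mulr_suml.
      by apply: eq_bigr => i _; rewrite -mulrBr mulrA.
    rewrite -[X in (X - _) * _]p1 -sumrB !mulr_suml -big_split/=.
    by apply: eq_bigr => i _; ring.
  apply: ler_sum => i _; apply: (ler_wpM2l (p0 i)).
  by rewrite -{1}(lE (x i)); exact: conv (l01 _ _) aab bab.
have Yab : a + b - X \in `[a, b].
  by move: Xab; rewrite !in_itv/= => /andP[? ?]; apply/andP; split; lra.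
have hY : h (a + b - X) <= (1 - l X) * h a + l X * h b.
  rewrite -lrE -{2 4}(subKr 1 (l X)); apply: conv => //.
  by have /andP[? ?] := l01 _ Xab; apply/andP; split; lra.
have hmid : h ((a + b) / 2) <= 1 / 2 * h X + (1 - 1 / 2) * h (a + b - X).
  have -> : (a + b) / 2 = 1 / 2 * X + (1 - 1 / 2) * (a + b - X) by field.
  by apply: conv => //; apply/andP; split; lra.
lra.
Qed.

Lemma jensen_linear (R : realType) n (p x : 'I_n -> R) (f k : R -> R) e c :
  jensen p x (fun t => e * f t + c * k t)
  = e * jensen p x f + c * jensen p x k.
Proof.
rewrite /jensen.
under eq_bigr do rewrite mulrDr !(mulrCA (p _)).
by rewrite big_split/= -!mulr_sumr; ring.
Qed.

(** The parameter [e] allows [g] to enter with either sign. *)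
Lemma C2_on_add_sqr_convex (R : realType) (a b : R) (g : R -> R) (e c : R) :
  C2_on `[a, b] g ->
  (forall t, t \in `[a, b] -> 0 <= e * derive2_on `[a, b] g t + 2 * c) ->
  convex_function (`[a, b]%classic : set R) (fun t => e * g t + c * t ^+ 2).
Proof.
case=> dg ddg _ h2; set h := fun t => e * g t + c * t ^+ 2.
have ch : {within `[a, b], continuous h}.
  apply/subspace_continuousP => t tab.
  have /subspace_continuousP/(_ t tab) := derivable_on_within_continuous dg.
  move=> cg; apply: cvgD; apply: cvgM; try exact: cvg_cst; try exact: cg.
  by apply: cvgM; exact: cvg_within.
have dh z : z \in `]a, b[ ->
    is_derive z 1 h (e * derive_on `[a, b] g z + 2 * c * z).
  move=> zab; have zE : `[a, b]%classic° z by rewrite interior_itv.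
  have ? := derivable_on_is_derive dg zE.
  by apply: is_derive_eq; rewrite /GRing.scale/=; ring.
have ddh z : z \in `]a, b[ ->
    is_derive z 1 ('D_1 h) (e * derive2_on `[a, b] g z + 2 * c).
  move=> zab; have zE : `[a, b]%classic° z by rewrite interior_itv.
  have ? := derivable_on_is_derive ddg zE.
  apply: (@near_eq_is_derive _ _ _
      (fun t => e * derive_on `[a, b] g t + 2 * c * t)).
    have : \forall t \near z, t \in `]a, b[ by exact: near_in_itvoo.
    by apply: filterS => t /dh/(@derive_val _ _ _ _ _ _ _) ->.
  by apply: is_derive_eq; rewrite /GRing.scale/= mulr1.
(* The second derivative test concerns the endpoints of its interval, hence
   its use on each subinterval [[u, w]]. *)
have convex_le (t : {i01 R}) u w : u \in `[a, b] -> w \in `[a, b] -> u <= w ->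
    h (conv t (u : R^o) (w : R^o)) <= conv t (h u : R^o) (h w : R^o).
  rewrite !in_itv/= => /andP[au ub] /andP[aw wb].
  rewrite le_eqVlt => /predU1P[<-|uw]; first by rewrite !convmm.
  have sub z : z \in `]u, w[ -> z \in `]a, b[.
    by rewrite !in_itv/= => /andP[? ?]; apply/andP; split; lra.
  have : {within `[u, w], continuous h}.
    by apply: continuous_subspaceW ch; apply: subset_itv; rewrite bnd_simp.
  move=> /(continuous_within_itvP _ uw)[_ hu hw].
  apply: second_derivative_convex => //; last exact: ltW.
  - move=> z zuw; have zab : z \in `]a, b[ by apply: sub; rewrite in_itv.
    rewrite (@derive_val _ _ _ _ _ _ _ (ddh z zab)); apply: h2.
    exact: subset_itv_oo_cc.
  - by move=> z /sub/dh[].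
  - by move=> z /sub/ddh[].
move=> t u w; rewrite !inE/= => uab wab.
have [uw|/ltW wu] := leP u w; first exact: convex_le.
by rewrite convC [leRHS]convC; exact: convex_le.
Qed.

(** By the extreme value theorem the set of maxima is nonempty, so that the
    default value in [max_on] does not occur. *)
Lemma max_onP (R : realType) (E : set R) (f : R -> R) :
  compact E -> E !=set0 -> {within E, continuous f} ->
  ubound (f @` E) (max_on E f).
Proof.
move=> cE E0 cf; have [c cinE cmax] := compact_EVT_max E0 cE cf.
rewrite /max_on; case: xgetP => [y _ []//|/(_ (f c))[]].
split; first by exists c => //; exact: set_mem.
by move=> _ [t Et <-]; apply: cmax; exact: mem_set.
Qed.

Lemma min_onP (R : realType) (E : set R) (f : R -> R) :
  compact E -> E !=set0 -> {within E, continuous f} ->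
  lbound (f @` E) (min_on E f).
Proof.
move=> cE E0 cf; have [c cinE cmin] := compact_EVT_min E0 cE cf.
rewrite /min_on; case: xgetP => [y _ []//|/(_ (f c))[]].
split; first by exists c => //; exact: set_mem.
by move=> _ [t Et <-]; apply: cmin; exact: mem_set.
Qed.

Theorem theorem2p12 (R : realType) (a b : R) (g : R -> R) (n : nat)
    (p x : 'I_n -> R)
    (E := `[a, b]%classic : set R)
    (hab : a < b)
    (hg : C2_on E g)
    (hx : forall i, E (x i))
    (hp : forall i, 0 < p i)
    (hp1 : \sum_(i < n) p i = 1) :
  g a + g b - 2 * g ((a + b) / 2)
    + 1 / 4 * M_ g E * (2 * jensen p x (fun t => t ^+ 2) - (b - a) ^+ 2)
      <= jensen p x g
  /\
  jensen p x g
    <= g a + g b - 2 * g ((a + b) / 2)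
      + 1 / 4 * m_ g E * (2 * jensen p x (fun t => t ^+ 2) - (b - a) ^+ 2).
Proof.
have main e c :
    (forall t, t \in `[a, b] -> 0 <= e * derive2_on E g t + 2 * c) ->
    e * jensen p x g + c * jensen p x (fun t => t ^+ 2)
    <= e * (g a + g b - 2 * g ((a + b) / 2)) + c * (b - a) ^+ 2 / 2.
  move=> /(C2_on_add_sqr_convex hg) ch.
  have := jensen_le_endpoints hab ch hx (fun i => ltW (hp i)) hp1.
  by rewrite jensen_linear; lra.
have [_ _ cg] := hg.
have E0 : E !=set0 by exists a; rewrite /E/= in_itv/= lexx ltW.
have cE : compact E := segment_compact (a:=a) (b:=b).
split.
- have /main : forall t, t \in `[a, b] ->
      0 <= -1 * derive2_on E g t + 2 * (M_ g E / 2).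
    move=> t tE; have : derive2_on E g t <= M_ g E; last by lra.
    by apply: (max_onP cE E0 cg); exists t.
  by set S := jensen p x (fun t => t ^+ 2); lra.
- have /main : forall t, t \in `[a, b] ->
      0 <= 1 * derive2_on E g t + 2 * (- (m_ g E / 2)).
    move=> t tE; have : m_ g E <= derive2_on E g t; last by lra.
    by apply: (min_onP cE E0 cg); exists t.
  by set S := jensen p x (fun t => t ^+ 2); lra.
Qed.
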